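(* There is an absolute constant $C>0$ such that the following holds. Let $k\ge 2$ and $\alpha$ be integers with $\tfrac{k}{2}<\alpha\le k$ and let $g:\mathbb N\to\mathbb R_{\ge 0}$ satisfy $g(n)\in o(n)$. Then for all sufficiently large $n$ there is an initial assignment of opinions in $\{0,1\}$ to the $n$ parties such that the expected number of rounds until Slush with parameters $k,\alpha$ (without any adversary) first reaches a state in which at least $n-g(n)$ parties hold the same opinion is at least $C\,\frac{\log n}{\log k}$. In other words, Slush takes $\Omega\big(\frac{\log n}{\log k}\big)$ rounds in expectation to reach a stable consensus.
   Context: Slush (synchronous, binary): there are $n$ parties $\{1,\dots,n\}$, each holding an opinion in $\{0,1\}$. In each round every party independently draws a sample of $k$ parties uniformly at random with repetition from all $n$ parties (samples are independent across parties and rounds) and looks at the opinions held by the sampled parties at the end of the previous round. If at least $\alpha$ of the $k$ sampled opinions equal $b$, the party adopts opinion $b$; otherwise it keeps its opinion. All updates in a round are simultaneous, and the process runs without a round limit. The system is in a state of stable consensus if at least $n-o(n)$ parties hold the same opinion; here $o(n)$ is represented by the function $g$. *)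

(* Defs.v *)
From HB Require Import structures.
From mathcomp Require Import all_boot all_order all_algebra.
From mathcomp Require Import all_classical all_reals all_analysis.

Set Implicit Arguments.
Unset Strict Implicit.
Unset Printing Implicit Defensive.

Import Order.TTheory GRing.Theory Num.Theory.
Import numFieldNormedType.Exports.

Local Open Scope classical_set_scope.
Local Open Scope ring_scope.

Definition opinions (n : nat) := {ffun 'I_n -> bool}.

(* A sample is an ordered k-tuple of parties, possibly with repetitions and
   possibly containing the sampling party itself. *)
Definition sample (n k : nat) := (k.-tuple 'I_n)%type.

Definition votes (n k : nat) (x : opinions n) (s : sample n k) (b : bool) :
    nat :=
  count (fun j => x j == b) s.

(* The order of the two tests is immaterial when k < 2 * alpha, since then at
   most one opinion can gather alpha votes. *)
Definition slush_step (n k alpha : nat) (x : opinions n)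
    (s : 'I_n -> sample n k) : opinions n :=
  [ffun i => if (alpha <= votes x (s i) true)%N then true
             else if (alpha <= votes x (s i) false)%N then false
             else x i].

(* [S t i] is the sample drawn by party [i] in round [t.+1]. *)
Fixpoint slush_state (n k alpha : nat) (x0 : opinions n)
    (S : nat -> 'I_n -> sample n k) (t : nat) : opinions n :=
  if t is t'.+1 then slush_step alpha (slush_state alpha x0 S t') (S t')
  else x0.

Definition stable_consensus (R : realType) (n : nat) (g : nat -> R)
    (x : opinions n) : Prop :=
  exists b : bool, n%:R - g n <= #|[set i | x i == b]%SET|%:R.

(* Number of rounds until stable consensus is first reached; it is [+oo] (the
   infimum of the empty set) if this never happens. *)
Definition consensus_time (R : realType) (n k alpha : nat) (g : nat -> R)
    (x0 : opinions n) (S : nat -> 'I_n -> sample n k) : \bar R :=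
  ereal_inf [set t%:R%:E | t in
    [set t : nat | stable_consensus g (slush_state alpha x0 S t)]].

Section sampling.
Context (d : measure_display) (Omega : measurableType d) (R : realType).
Context (P : probability Omega R).

(* Mutual independence of a family of random variables whose values lie in a
   finite type [V], all of whose subsets are regarded as measurable. *)
Definition independent_family (I : eqType) (V : finType)
    (X : I -> Omega -> V) : Prop :=
  forall (J : seq I) (A : I -> set V), uniq J ->
    P (\bigcap_(i in [set` J]) (X i @^-1` A i)) =
    (\prod_(i <- J) P (X i @^-1` A i))%E.

Definition uniform_variable (V : finType) (X : Omega -> V) : Prop :=
  forall v : V, P (X @^-1` [set v]) = (#|V|%:R^-1)%:E.

Definition slush_sampling (n k : nat)
    (S : Omega -> nat -> 'I_n -> sample n k) : Prop :=
  [/\ forall t i (A : set (sample n k)),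
        measurable ((fun w => S w t i) @^-1` A),
      forall t i, uniform_variable (fun w => S w t i)
    & independent_family (fun (ti : nat * 'I_n) w => S w ti.1 ti.2)].

End sampling.

(* Main.v *)
Require Import Defs.
From HB Require Import structures.
From mathcomp Require Import all_boot all_order all_algebra.
From mathcomp Require Import all_classical all_reals all_analysis.
From mathcomp Require Import ring lra zify.

Set Implicit Arguments.
Unset Strict Implicit.
Unset Printing Implicit Defensive.

Import Order.TTheory GRing.Theory Num.Theory.
Import numFieldNormedType.Exports.

Local Open Scope classical_set_scope.
Local Open Scope ring_scope.

(* The imbalance D (number of ones minus number of zeros) is controlled by its
   second moment.  Exchanging the two opinions of one sampled party at a time
   shows that a round multiplies the conditional mean of D by at most k + 1 in
   absolute value, and the n independent updates add a variance of at most n,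
   so E[D'^2] <= (k + 1)^2 D^2 + n.  Started from a balanced assignment, the
   probability of a consensus (where D^2 >= n^2 / 4) at round t is therefore
   at most 8 ((k + 1)^2 + 1)^t / n.  As (k + 1)^2 + 1 <= k^4, summing over the
   rounds up to T = floor (log_k n) / 6 leaves probability at least 1/2 that no
   consensus occurs before round T + 1. *)

(** * Counting bounds for sums over independent samples *)

Section combinatorics.
Context (R : realType).

Lemma big_tuple_cons (T : finType) (k : nat) (F : k.+1.-tuple T -> R) :
  \sum_v F v = \sum_i \sum_(v : k.-tuple T) F [tuple of i :: v].
Proof.
rewrite pair_big /=.
rewrite (reindex (fun p : T * k.-tuple T => [tuple of p.1 :: p.2])) //=.
exists (fun v => (thead v, [tuple of behead v])) => [[i v] _|v _] /=.
  by congr pair; apply/val_inj.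
by apply/val_inj; case/tupleP: v.
Qed.

(** Second moment of a sum of independent variables, in counting form with denominators cleared.
    Off-diagonal products factor into means, and each diagonal term averages to at most 1. *)
Lemma sqr_sum_independent (I V : finType) (u : I -> V -> R) :
  (forall i v, `|u i v| <= 1) ->
  \sum_(s : {ffun I -> V}) (\sum_i u i (s i)) ^+ 2 * #|V|%:R ^+ 2 <=
  #|{ffun I -> V}|%:R * ((\sum_i \sum_v u i v) ^+ 2 + #|I|%:R * #|V|%:R ^+ 2).
Proof.
move=> u1.
have offdiag i j : i != j ->
    \sum_(s : {ffun I -> V}) u i (s i) * u j (s j) * #|V|%:R ^+ 2 =
    #|{ffun I -> V}|%:R * ((\sum_v u i v) * (\sum_v u j v)).
  move=> ij.
  (* Padding with factors 1 turns the pair product into a product over all coordinates, whose sum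
     over functions factors. *)
  pose F l v : R := if l == i then u i v else if l == j then u j v else 1.
  have split3 (G : I -> R) :
      \prod_l G l = G i * (G j * \prod_(l | (l != i) && (l != j)) G l).
    by rewrite (bigD1 i) //= (bigD1 j) //= eq_sym.
  have ji : j == i = false by rewrite eq_sym (negbTE ij).
  have prodF (s : {ffun I -> V}) : u i (s i) * u j (s j) = \prod_l F l (s l).
    rewrite split3 /F eqxx ji eqxx big1 ?mulr1 // => l /andP[li lj].
    by rewrite (negbTE li) (negbTE lj).
  rewrite -mulr_suml; under eq_bigr do rewrite prodF.
  rewrite -(bigA_distr_bigA F) split3 /F eqxx ji eqxx.
  rewrite [X in _ * (_ * X)](eq_bigr (fun=> #|V|%:R)); last first.
    move=> l /andP[li lj].
    by rewrite (negbTE li) (negbTE lj) sumr_const.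
  rewrite card_ffun natrX -prodr_const (split3 (fun=> _)).
  by ring.
have diag i : \sum_(s : {ffun I -> V}) u i (s i) * u i (s i) * #|V|%:R ^+ 2 <=
    #|{ffun I -> V}|%:R * #|V|%:R ^+ 2.
  rewrite -mulr_suml ler_wpM2r ?exprn_ge0 //.
  rewrite -[leRHS]mulr1 mulr_natl -sumr_const; apply: ler_sum => s _.
  by rewrite -expr2 -real_normK ?num_real // expr_le1.
have -> : \sum_(s : {ffun I -> V}) (\sum_i u i (s i)) ^+ 2 * #|V|%:R ^+ 2 =
    \sum_i \sum_j \sum_(s : {ffun I -> V}) u i (s i) * u j (s j) * #|V|%:R ^+ 2.
  under [RHS]eq_bigr do rewrite exchange_big /=.
  rewrite exchange_big /=; apply: eq_bigr => s _.
  rewrite expr2 big_distrl mulr_suml /=; apply: eq_bigr => i _.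
  by rewrite big_distrr mulr_suml.
rewrite [X in _ * (X + _)]expr2 [X in _ * (X + _)]big_distrl /= mulrDr.
have -> : #|{ffun I -> V}|%:R * (#|I|%:R * #|V|%:R ^+ 2) =
   \sum_(i : I) (#|{ffun I -> V}|%:R * #|V|%:R ^+ 2 : R).
  by rewrite sumr_const -mulr_natl; ring.
rewrite mulr_sumr -big_split /=; apply: ler_sum => i _.
rewrite [X in _ * X + _]big_distrr mulr_sumr /=.
rewrite [leLHS](bigD1 i) //= [X in _ <= X + _](bigD1 i) //=.
rewrite [X in _ + X <= _](eq_bigr (fun j =>
  #|{ffun I -> V}|%:R * ((\sum_v u i v) * (\sum_v u j v)))); last first.
  by move=> j ji; rewrite offdiag // eq_sym.
rewrite [leRHS]addrAC lerD2r.
by rewrite (le_trans (diag i)) // lerDr -expr2 mulr_ge0 // sqr_ge0.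
Qed.

(* Passing from [map f v] to [map f' v] one coordinate at a time; [M] bounds the
   change caused by each coordinate. *)
Lemma hybrid_bound (I : finType) (T : Type) (f f' : I -> T) (M : R) :
    (forall h : T -> bool, `|\sum_i ((h (f i))%:R - (h (f' i))%:R) : R| <= M) ->
  forall (k : nat) (G : seq T -> bool),
  `|\sum_(v : k.-tuple I) ((G (map f v))%:R - (G (map f' v))%:R)|
    * #|I|%:R <= k%:R * M * #|I|%:R ^+ k.
Proof.
move=> hM; elim=> [|k IH] G.
  by rewrite big1 ?normr0 ?mul0r // => v _; rewrite tuple0 /= subrr.
rewrite big_tuple_cons.
(* The tail is exchanged first, with the head fixed at [f i], which is [IH]; then the head, where
   [hM] applies for each tail. *)
have -> : \sum_i \sum_(v : k.-tuple I)
      ((G (map f [tuple of i :: v]))%:R - (G (map f' [tuple of i :: v]))%:R) =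
    \sum_i \sum_(v : k.-tuple I)
      ((G (f i :: map f v))%:R - (G (f i :: map f' v))%:R) +
    \sum_(v : k.-tuple I) \sum_i
      ((G (f i :: map f' v))%:R - (G (f' i :: map f' v))%:R) :> R.
  rewrite [X in _ + X]exchange_big -big_split; apply: eq_bigr => i _.
  rewrite -big_split; apply: eq_bigr => v _ /=; ring.
apply: (@le_trans _ _ ((\sum_(i : I) `|\sum_(v : k.-tuple I)
      ((G (f i :: map f v))%:R - (G (f i :: map f' v))%:R)| +
    \sum_(v : k.-tuple I) `|\sum_i
      ((G (f i :: map f' v))%:R - (G (f' i :: map f' v))%:R)|) * #|I|%:R)).
  rewrite ler_wpM2r //; apply: le_trans (ler_normD _ _) _.
  by apply: lerD; exact: ler_norm_sum.
rewrite mulrDl mulr_suml -[k.+1%:R]natr1 2!mulrDl mul1r exprSr.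
apply: lerD.
  rewrite mulrA [leRHS]mulr_natr -[leRHS]sumr_const.
  by apply: ler_sum => i _; exact: (IH (fun s => G (f i :: s))).
rewrite mulrA ler_wpM2r //.
rewrite -natrX -card_tuple mulr_natr -[leRHS]sumr_const.
by apply: ler_sum => v _; exact: (hM (fun b => G (b :: _))).
Qed.

End combinatorics.

(** * Drift and second moment of the imbalance in one round *)

Section one_round.
Context (R : realType) (n k alpha : nat).
Hypotheses (n_gt0 : (0 < n)%N) (k_lt_2alpha : (k < 2 * alpha)%N).
Implicit Types (x : opinions n) (v : sample n k).

Definition imbalance x : R := \sum_i (-1) ^+ ~~ x i.

(** Stated on booleans so that the test for opinion 0 is the same predicate on negated opinions; the
    two tests then fit [hybrid_bound] with [x] and [negb \o x]. *)
Definition majority (s : seq bool) : bool := (alpha <= count id s)%N.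

Lemma votes_true x v : (alpha <= votes x v true)%N = majority (map x v).
Proof.
by rewrite /majority /votes count_map; congr (_ <= _)%N; apply: eq_count => j /=;
  case: (x j).
Qed.

Lemma votes_false x v :
  (alpha <= votes x v false)%N = majority (map (negb \o x) v).
Proof.
by rewrite /majority /votes count_map; congr (_ <= _)%N; apply: eq_count => j /=;
  case: (x j).
Qed.

Lemma majority_exclusive x v :
  ~~ (majority (map x v) && majority (map (negb \o x) v)).
Proof.
rewrite /majority !count_map; apply/negP => /andP[/= h1 h2].
move: (leq_add h1 h2); rewrite addnn -mul2n leqNgt => /negP; apply.
suff -> : (count (preim x id) v + count (preim (negb \o x) id) v)%N = k by [].
by rewrite -[RHS](size_tuple v) -(count_predC x).
Qed.

(** For fixed [x] this depends on the sample of party [i] alone, so the new imbalance is a sum of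
    independent terms. *)
Definition new_sign x i v : R :=
  if majority (map x v) then 1
  else if majority (map (negb \o x) v) then -1 else (-1) ^+ ~~ x i.

Lemma imbalance_slush_step x (s : 'I_n -> sample n k) :
  imbalance (slush_step alpha x s) = \sum_i new_sign x i (s i).
Proof.
apply: eq_bigr => i _; rewrite ffunE /new_sign -votes_true -votes_false.
by case: ifP => // _; case: ifP.
Qed.

Lemma majority_bias x :
  `|\sum_(v : sample n k) ((majority (map x v))%:R
            - (majority (map (negb \o x) v))%:R)| * n%:R
    <= k%:R * `|imbalance x| * #|{: sample n k}|%:R.
Proof.
have := @hybrid_bound R _ _ x (negb \o x) `|imbalance x| _ k majority.
rewrite card_tuple natrX card_ord; apply => h.
(* Exchanging one coordinate contributes [c] times the imbalance, and [c] is -1, 0 or 1. *)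
pose c : R := (h true)%:R - (h false)%:R.
rewrite (eq_bigr (fun i => c * (-1) ^+ ~~ x i)); last first.
  by move=> i _; rewrite /c /=; case: (x i) => /=; ring.
rewrite -mulr_sumr normrM -[leRHS]mul1r ler_wpM2r // /c.
by case: (h true); case: (h false);
  rewrite ?subrr ?subr0 ?sub0r ?normr0 ?normrN ?normr1.
Qed.

(** In the factor k + 1, the k comes from [majority_bias] and the 1 from samples in which neither
    opinion gathers [alpha] votes, where every party keeps its sign. *)
Lemma mean_new_sign_bound x :
  `|\sum_i \sum_(v : sample n k) new_sign x i v| <=
    k.+1%:R * `|imbalance x| * #|{: sample n k}|%:R.
Proof.
pose keep v : R := 1 - (majority (map x v))%:R
                     - (majority (map (negb \o x) v))%:R.
pose K := \sum_(v : sample n k) keep v.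
have -> : \sum_i \sum_(v : sample n k) new_sign x i v =
   (\sum_(v : sample n k) ((majority (map x v))%:R
            - (majority (map (negb \o x) v))%:R)) * n%:R
   + imbalance x * K.
  rewrite -[n in n%:R]card_ord mulr_natr -sumr_const mulr_suml -big_split /=.
  apply: eq_bigr => i _; rewrite mulr_sumr -big_split /=; apply: eq_bigr => v _.
  rewrite /new_sign /keep; have := majority_exclusive x v.
  by case: (majority _); case: (majority _) => //= _; ring.
have [K0 KV] : 0 <= K /\ K <= #|{: sample n k}|%:R.
  have b v : 0 <= keep v <= 1.
    rewrite /keep; have := majority_exclusive x v.
    by case: (majority _); case: (majority _) => //= _; lra.
  split; first by apply: sumr_ge0 => v _; case/andP: (b v).
  by rewrite -sumr_const; apply: ler_sum => v _; case/andP: (b v).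
apply: le_trans (ler_normD _ _) _.
rewrite !normrM (ger0_norm K0) normr_nat -natr1 2!mulrDl mul1r.
by apply: lerD; [exact: majority_bias | rewrite ler_wpM2l].
Qed.

Lemma sqr_imbalance_step x :
  \sum_(s : {ffun 'I_n -> sample n k}) imbalance (slush_step alpha x s) ^+ 2 <=
  #|{ffun 'I_n -> sample n k}|%:R * (k.+1%:R ^+ 2 * imbalance x ^+ 2 + n%:R).
Proof.
under eq_bigr do rewrite imbalance_slush_step.
have V0 : 0 < #|{: sample n k}|%:R ^+ 2 :> R.
  by rewrite exprn_gt0 // ltr0n card_tuple card_ord expn_gt0 n_gt0.
rewrite -(ler_pM2r V0) mulr_suml.
apply: le_trans (sqr_sum_independent _) _.
  move=> i v; rewrite /new_sign.
  case: ifP => _; last case: ifP => _; rewrite ?normrN ?normr1 //.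
  by rewrite normrX normrN1 expr1n.
rewrite card_ord -mulrA ler_wpM2l // mulrDl lerD2r.
rewrite -[leLHS]real_normK ?num_real // -[imbalance x ^+ 2]real_normK ?num_real //.
by rewrite -!exprMn lerXn2r ?nnegrE ?mulr_ge0 // mean_new_sign_bound.
Qed.

End one_round.

(** If m parties hold the consensus opinion, then D is 2m - n up to sign, and m >= 3n/4 gives |D| >=
    n/2. *)
Lemma sqr_imbalance_consensus (R : realType) (n : nat) (g : nat -> R)
    (x : opinions n) :
  g n <= n%:R / 4 -> stable_consensus g x -> n%:R ^+ 2 / 4 <= imbalance R x ^+ 2.
Proof.
move=> gn [b hb].
have E : imbalance R x = (-1) ^+ (~~ b) * (2 * #|[set i | x i == b]%SET|%:R - n%:R).
  have -> : n%:R = \sum_(i < n) 1 :> R by rewrite sumr_const card_ord.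
  rewrite -sum1_card natr_sum big_mkcond mulr_sumr -sumrB mulr_sumr.
  apply: eq_bigr => i _; rewrite inE.
  by case: (x i); case: b {hb} => /=; ring.
rewrite E exprMn -exprM mulnC exprM sqrrN !expr1n mul1r.
by have : 0 <= n%:R :> R by []; nra.
Qed.

(** * Measurability, and conditioning on sampled histories *)

Section sampling_process.
Context (d : measure_display) (Omega : measurableType d) (R : realType).
Context (P : probability Omega R).

Lemma measurable_preimage_fin (V : finType) (X : Omega -> V) :
    (forall v, measurable (X @^-1` [set v])) ->
  forall A, measurable (X @^-1` A).
Proof.
move=> mX A; have -> : X @^-1` A = \bigcup_(v in A) X @^-1` [set v].
  by apply/seteqP; split => [w Aw|w [v Av /= Xw]]; [exists (X w)|rewrite /= Xw].
by apply: fin_bigcup_measurable => //; exact: finite_finset.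
Qed.

Lemma measurable_preimage_ffun (I V : finType) (X : Omega -> I -> V) :
    (forall i A, measurable ((fun w => X w i) @^-1` A)) ->
  forall A, measurable ((fun w => [ffun i => X w i]) @^-1` A).
Proof.
move=> mX; apply: measurable_preimage_fin => f.
have -> : (fun w => [ffun i => X w i]) @^-1` [set f] =
    \bigcap_(i in [set: I]) (fun w => X w i) @^-1` [set f i].
  apply/seteqP; split => [w /= <- i _|w Xf]; first by rewrite /= ffunE.
  by apply/ffunP => i; rewrite ffunE; exact: Xf.
by apply: fin_bigcap_measurable => // i _; exact: mX.
Qed.

Lemma measurable_preimage_op (V1 V2 : finType) (V : Type) (op : V1 -> V2 -> V)
    (X : Omega -> V1) (Y : Omega -> V2) :
    (forall A, measurable (X @^-1` A)) -> (forall A, measurable (Y @^-1` A)) ->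
  forall A, measurable ((fun w => op (X w) (Y w)) @^-1` A).
Proof.
move=> mX mY A.
have -> : (fun w => op (X w) (Y w)) @^-1` A =
    \bigcup_(x in [set: V1]) (X @^-1` [set x] `&` Y @^-1` (op x @^-1` A)).
  by apply/seteqP; split => [w Aw|w [x _ [/= -> ]]] //; exists (X w).
by apply: fin_bigcup_measurable => // x _; exact: measurableI.
Qed.

Lemma union_bound (I : choiceType) (r : seq I) (A : set Omega)
    (B : I -> set Omega) (f : I -> R) :
    uniq r -> measurable A -> (forall i, measurable (B i)) ->
    (forall w, A w -> exists2 i, i \in r & B i w) ->
    (forall i, (P (B i) <= (f i)%:E)%E) ->
  (P A <= (\sum_(i <- r) f i)%:E)%E.
Proof.
move=> r_uniq mA mB AB Bf.
apply: le_trans (content_sub_fsum (D := [set` r]) (A_ := B) P _ _ _ _) _ => //.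
rewrite -fsbig_seq // -sumEFin; apply: lee_sum => i _; exact: Bf.
Qed.

Context (n k alpha : nat) (x0 : opinions n).
Context (S : Omega -> nat -> 'I_n -> sample n k) (samplingS : slush_sampling P S).
Hypotheses (n_gt0 : (0 < n)%N) (k_lt_2alpha : (k < 2 * alpha)%N).

Lemma measurable_slush_state t A :
  measurable ((fun w => slush_state alpha x0 (S w) t) @^-1` A).
Proof.
have [mS _ _] := samplingS.
elim: t A => [|t IH] A /=.
  by apply: measurable_preimage_fin A => y; rewrite preimage_cst; case: ifP.
pose op (x : opinions n) (s : {ffun 'I_n -> sample n k}) := slush_step alpha x s.
have -> : (fun w => slush_step alpha (slush_state alpha x0 (S w) t) (S w t)) =
    (fun w => op (slush_state alpha x0 (S w) t) [ffun i => S w t i]).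
  by apply/funext => w; apply/ffunP => i; rewrite !ffunE.
by apply: measurable_preimage_op => //; exact: measurable_preimage_ffun.
Qed.

(** Intersecting with this event replaces conditioning on the first [t] rounds; the values of [h]
    from index [t] on are ignored. *)
Definition cylinder (h : nat -> 'I_n -> sample n k) (t : nat) : set Omega :=
  [set w | forall j i, (j < t)%N -> S w j i = h j i].

Let rounds t : seq (nat * 'I_n) := [seq (j, i) | j <- iota 0 t, i <- enum 'I_n].

Let cylinderE h t : cylinder h t =
  \bigcap_(ji in [set` rounds t]) (fun w => S w ji.1 ji.2) @^-1` [set h ji.1 ji.2].
Proof.
apply/seteqP; split=> [w hw [j i] /= /allpairsP[[j' i'] /= [jt _ [-> ->]]]|].
  by apply: hw; move: jt; rewrite mem_iota.
move=> w hw j i jt; apply: (hw (j, i)) => /=; apply/allpairsP.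
by exists (j, i); rewrite /= mem_iota mem_enum.
Qed.

Lemma measurable_cylinder h t : measurable (cylinder h t).
Proof.
have [mS _ _] := samplingS.
by rewrite cylinderE; apply: fin_bigcap_measurable => // i _; exact: mS.
Qed.

(** Independence is applied to the list of all pairs of a round index below [t] and a party; the n
    uniform factors of one round combine into the inverse number of joint samples. *)
Lemma probability_cylinder h t :
  P (cylinder h t) = (#|{ffun 'I_n -> sample n k}|%:R ^- t)%:E.
Proof.
have [_ uS iS] := samplingS.
have uniq_rounds : uniq (rounds t).
  apply: allpairs_uniq; rewrite ?iota_uniq ?enum_uniq //.
  by move=> [? ?] [? ?] _ _ [-> ->].
rewrite cylinderE iS // (eq_bigr (fun=> (#|{: sample n k}|%:R^-1)%:E)).
  rewrite prodEFin big_const_seq count_predT iter_mulr_1 size_allpairs size_iota.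
  by rewrite size_enum_ord card_ffun card_ord natrX mulnC exprM !exprVn.
by move=> [j i] _; exact: uS.
Qed.

Lemma slush_state_prefix (s s' : nat -> 'I_n -> sample n k) t :
    (forall j i, (j < t)%N -> s j i = s' j i) ->
  slush_state alpha x0 s t = slush_state alpha x0 s' t.
Proof.
elim: t => //= t IH ss'.
rewrite IH; last by move=> j i jt; apply: ss'; exact: ltnW.
by apply/ffunP => i; rewrite !ffunE ss'.
Qed.

Let resample (h : nat -> 'I_n -> sample n k) t (s : {ffun 'I_n -> sample n k}) :
  nat -> 'I_n -> sample n k := fun j i => if j == t then s i else h j i.

(* The case [t = 0] is the bound on the probability of a consensus at round
   [m]; conditioning on the first [t] rounds makes the induction on [m] go
   through, by splitting a cylinder according to the samples of round [t.+1]. *)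
Lemma slush_consensus_prob_cylinder (g : nat -> R) m : g n <= n%:R / 4 ->
  forall h t,
  (P (cylinder h t `&`
      (fun w => slush_state alpha x0 (S w) (t + m)) @^-1`
        [set x | stable_consensus g x])
   <= (#|{ffun 'I_n -> sample n k}|%:R ^- t
        * (k.+1%:R ^+ 2 + 1) ^+ m
        * (imbalance R (slush_state alpha x0 h t) ^+ 2 + n%:R)
        * (4 / n%:R ^+ 2))%:E)%E.
Proof.
move=> gn; set W : R := #|{ffun _}|%:R.
have n_pos : 0 < n%:R :> R by rewrite ltr0n.
have W_pos : 0 < W.
  by rewrite ltr0n card_ffun expn_gt0 card_tuple !card_ord expn_gt0 n_gt0.
elim: m => [|m IH] h t.
  (* On the cylinder, [h] determines the state after [t] rounds: either it is a consensus and (D^2 +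
     n) * 4 / n^2 >= 1, or the event is empty. *)
  rewrite addn0 expr0 mulr1.
  have [Ch|nCh] := pselect (stable_consensus g (slush_state alpha x0 h t)).
    apply: (@le_trans _ _ (P (cylinder h t))).
      by apply: le_measure; rewrite ?inE //; [apply: measurableI|..];
        [exact: measurable_cylinder|exact: measurable_slush_state
        |exact: measurable_cylinder].
    rewrite probability_cylinder lee_fin -mulrA -[leLHS]mulr1.
    rewrite ler_wpM2l ?invr_ge0 ?exprn_ge0 ?(ltW W_pos) // mulrA.
    rewrite ler_pdivlMr ?exprn_gt0 // mul1r.
    have := sqr_imbalance_consensus gn Ch; lra.
  have -> : cylinder h t `&` (fun w => slush_state alpha x0 (S w) t) @^-1`
      [set x | stable_consensus g x] = set0.
    apply/seteqP; split => // w [/= hw]; rewrite (slush_state_prefix hw).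
    exact: nCh.
  rewrite measure0 lee_fin.
  by rewrite !mulr_ge0 ?invr_ge0 ?exprn_ge0 ?addr_ge0 ?sqr_ge0 ?(ltW W_pos).
(* Each of the [W] joint samples of the next round gives a longer cylinder, to which [IH]
   applies. *)
apply: le_trans (union_bound (r := index_enum {ffun 'I_n -> sample n k})
  (B := fun s => cylinder (resample h t s) t.+1 `&`
     (fun w => slush_state alpha x0 (S w) (t.+1 + m)) @^-1`
        [set x | stable_consensus g x]) _ _ _ _ (fun s => IH _ _)) _.
- exact: index_enum_uniq.
- by apply: measurableI; [exact: measurable_cylinder|exact: measurable_slush_state].
- move=> s.
  by apply: measurableI; [exact: measurable_cylinder|exact: measurable_slush_state].
- move=> w [hw Cw]; exists [ffun i => S w t i]; first by rewrite mem_index_enum.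
  split; last by move: Cw; rewrite addnS.
  move=> j i; rewrite ltnS leq_eqVlt /resample => /predU1P[->|jt].
    by rewrite eqxx ffunE.
  by rewrite ltn_eqF // hw.
rewrite lee_fin -/W -mulr_suml -mulr_sumr.
rewrite ler_wpM2r ?divr_ge0 ?exprn_ge0 //.
have stepE s : slush_state alpha x0 (resample h t s) t.+1 =
    slush_step alpha (slush_state alpha x0 h t) s.
  rewrite /= (@slush_state_prefix _ h) => [|j i jt]; last first.
    by rewrite /resample ltn_eqF.
  by apply/ffunP => i; rewrite !ffunE /resample eqxx.
under eq_bigr do rewrite stepE.
rewrite big_split /= sumr_const -[n%:R *+ _]mulr_natl -/W.
set x := slush_state alpha x0 h t.
have := sqr_imbalance_step R n_gt0 k_lt_2alpha x; rewrite -/W => step.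
have -> : W ^- t * (k.+1%:R ^+ 2 + 1) ^+ m.+1 * (imbalance R x ^+ 2 + n%:R) =
    W ^- t.+1 * (k.+1%:R ^+ 2 + 1) ^+ m *
      (W * ((k.+1%:R ^+ 2 + 1) * (imbalance R x ^+ 2 + n%:R))).
  by rewrite exprSr [W ^+ t.+1]exprS invfM; field; rewrite !gt_eqF ?exprn_gt0.
rewrite ler_wpM2l ?mulr_ge0 ?invr_ge0 ?exprn_ge0 ?addr_ge0 ?sqr_ge0 ?(ltW W_pos) //.
apply: le_trans (lerD step (lexx _)) _; rewrite -mulrDr ler_wpM2l ?(ltW W_pos) //.
(* Adding n to the square closes the recursion: (k + 1)^2 D^2 + 2n <= ((k + 1)^2 + 1)(D^2 + n). *)
have : 1 <= k.+1%:R ^+ 2 :> R by rewrite exprn_ege1 // ler1n.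
have := sqr_ge0 (imbalance R x); nra.
Qed.

End sampling_process.

(** * From the probability of an event to an expectation *)

Section integral_lower_bound.
Import HBNNSimple.

Lemma integral_ge_on_event (d : measure_display) (Omega : measurableType d)
    (R : realType) (P : probability Omega R) (A : set Omega) (c : R)
    (f : Omega -> \bar R) :
    measurable A -> 0 <= c -> (forall w, (0 <= f w)%E) ->
    (forall w, A w -> (c%:E <= f w)%E) ->
  (c%:E * P A <= \int[P]_w f w)%E.
Proof.
move=> mA c0 f0 cf.
(* [f] need not be measurable: the integral of a nonnegative function is a
   supremum over the simple functions below it. *)
rewrite -(sintegral_indic P A) -(sintegralrM P c (indic_nnsfun R mA)).
rewrite ge0_integralTE //; apply: ereal_sup_ubound.
exists (scale_nnsfun (indic_nnsfun R mA) c0) => // w /=.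
rewrite measurable_realfun.mindicE; case: (boolP (w \in A)) => [/set_mem Aw|_].
  by rewrite mulr1; exact: cf.
by rewrite mulr0.
Qed.

End integral_lower_bound.

(** * Choice of the parameters and the final estimate *)

Lemma round_count_bound (k n T : nat) : (2 <= k)%N -> (4 <= T)%N ->
  (k ^ (6 * T) <= n)%N -> (16 * (T.+1 * (k.+1 ^ 2 + 1) ^ T) <= n)%N.
Proof.
move=> k2 T4; apply: leq_trans.
(* The factors k^T, k^T and k^(4T) absorb 16, T + 1 and ((k + 1)^2 + 1)^T respectively; 16 <= 2^T
   uses 4 <= T. *)
rewrite (_ : 6 * T = T + (T + 4 * T))%N; last by lia.
rewrite 2!expnD expnM; apply: leq_mul; last apply: leq_mul.
- apply: (@leq_trans (2 ^ T)); last by rewrite leq_exp2r //; lia.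
  by rewrite (_ : 16 = 2 ^ 4)%N // leq_exp2l.
- apply: (@leq_trans (2 ^ T)); first exact: ltn_expl.
  by rewrite leq_exp2r //; lia.
- rewrite leq_exp2r; last by lia.
  by rewrite !expnS !expn0; nia.
Qed.

(** Alternating opinions serve both parities of [n]: the initial D^2 is at most 1. *)
Definition balanced (n : nat) : opinions n := [ffun i : 'I_n => odd i].

Lemma imbalance_balanced (R : realType) (n : nat) :
  imbalance R (balanced n) = - (odd n)%:R.
Proof.
rewrite /imbalance; under eq_bigr do rewrite ffunE.
elim: n => [|n IH]; first by rewrite big_ord0 oppr0.
by rewrite big_ord_recr /= IH; case: (odd n) => /=; ring.
Qed.

Lemma slush_early_consensus_prob (d : measure_display)
    (Omega : measurableType d) (R : realType) (P : probability Omega R)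
    (n k alpha T : nat) (g : nat -> R) (S : Omega -> nat -> 'I_n -> sample n k) :
    (0 < n)%N -> (k < 2 * alpha)%N -> g n <= n%:R / 4 ->
    slush_sampling P S -> (16 * (T.+1 * (k.+1 ^ 2 + 1) ^ T) <= n)%N ->
  (P [set w | exists2 t, (t <= T)%N &
       stable_consensus g (slush_state alpha (balanced n) (S w) t)]
     <= 2^-1%:E)%E.
Proof.
move=> n0 k2a gn hS nT.
have n_pos : 0 < n%:R :> R by rewrite ltr0n.
set B := fun t : nat => (fun w => slush_state alpha (balanced n) (S w) t) @^-1`
  [set x | stable_consensus g x].
have mB t : measurable (B t) by exact: (measurable_slush_state _ _ hS).
rewrite (_ : mkset _ = \bigcup_(t in [set` iota 0 T.+1]) B t); last first.
  apply/seteqP; split=> w [t tT Bt]; exists t => //; move: tT.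
    by rewrite -ltnS /mkset mem_iota.
  by rewrite /mkset mem_iota.
(* Initially D^2 <= 1 <= n, so (D^2 + n) * 4 / n^2 <= 8 / n. *)
pose b t : R := (k.+1%:R ^+ 2 + 1) ^+ t * (8 / n%:R).
have PB t : (P (B t) <= (b t)%:E)%E.
  (* With zero rounds fixed the cylinder is the whole space, so [S point] is just some history. *)
  have := slush_consensus_prob_cylinder (balanced n) hS n0 k2a t gn (S point) 0.
  rewrite (_ : cylinder _ _ 0 = setT); last by apply/seteqP; split.
  rewrite setTI add0n => /le_trans; apply.
  rewrite lee_fin expr0 invr1 mul1r /b /= imbalance_balanced sqrrN -mulrA.
  rewrite ler_wpM2l ?exprn_ge0 ?addr_ge0 ?sqr_ge0 //.
  have n1 : 1 <= n%:R :> R by rewrite ler1n.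
  have -> : 8 / n%:R = 8 * n%:R / n%:R ^+ 2 :> R by field; rewrite gt_eqF.
  rewrite mulrA ler_wpM2r ?invr_ge0 ?exprn_ge0 //.
  by case: (odd n) => /=; nra.
apply: le_trans (union_bound (r := iota 0 T.+1) (B := B) (f := b) _ _ mB _ PB) _.
- exact: iota_uniq.
- by apply: fin_bigcup_measurable => //; exact: finite_seq.
- by [].
rewrite lee_fin.
(* [b] is nondecreasing, so T + 1 copies of [b T] bound the sum; the factor 16 in the hypothesis
   brings 8 (T + 1) ((k + 1)^2 + 1)^T / n down to 1/2. *)
apply: (@le_trans _ _ (\sum_(t <- iota 0 T.+1) b T)).
  rewrite big_seq [leRHS]big_seq; apply: ler_sum => t.
  rewrite mem_iota add0n ltnS => tT.
  rewrite ler_wpM2r ?divr_ge0 // ler_weXn2l //.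
  by rewrite lerDr sqr_ge0.
rewrite big_const_seq count_predT size_iota iter_addr_0 /b -[leLHS]mulr_natl.
rewrite mulrA mulrA ler_pdivrMr //.
by move: nT; rewrite -(ler_nat R) !natrM natrX natrD natrX; lra.
Qed.

Theorem corollary4p5 (R : realType) :
  exists2 C : R, 0 < C &
  forall (k alpha : nat) (g : nat -> R),
    (2 <= k)%N -> (k < 2 * alpha)%N -> (alpha <= k)%N ->
    (forall n, 0 <= g n) ->
    (g : nat -> R^o) =o_\oo (fun n : nat => n%:R : R^o) ->
  exists N : nat, forall n : nat, (N <= n)%N ->
  exists x0 : opinions n,
  forall (d : measure_display) (Omega : measurableType d)
    (P : probability Omega R) (S : Omega -> nat -> 'I_n -> sample n k),
    slush_sampling P S ->
    ((C * (ln n%:R / ln k%:R))%:E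
       <= \int[P]_w consensus_time alpha g x0 (S w))%E.
Proof.
(* 1/12 is 1/2 times 1/6: with probability at least 1/2 no consensus occurs up to round [T], and ln
   n / ln k <= 6 (T + 1). *)
exists (12^-1); first by [].
move=> k alpha g k2 k2a ak g0 /eqoP go.
have [N _ gN] := go 4^-1 ltac:(by rewrite invr_gt0).
(* The bound k^24 <= n makes [trunc_log k n] at least 24, hence [T] at least 4. *)
exists (maxn N (k ^ 24)) => n; rewrite geq_max => /andP[Nn kn].
have n0 : (0 < n)%N by apply: leq_trans kn; rewrite expn_gt0; lia.
have gn : g n <= n%:R / 4.
  by move: (gN n Nn) => /=; rewrite normr_nat (ger0_norm (g0 n)) mulrC.
exists (balanced n) => d Omega P S hS.
set T := (trunc_log k n %/ 6)%N.
have logn : (24 <= trunc_log k n)%N by rewrite trunc_log_max.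
have T4 : (4 <= T)%N by rewrite /T; lia.
have nT : (16 * (T.+1 * (k.+1 ^ 2 + 1) ^ T) <= n)%N.
  apply: round_count_bound => //.
  apply: leq_trans (trunc_logP k2 n0).
  by rewrite leq_exp2l // /T; lia.
pose E := [set w | exists2 t, (t <= T)%N &
       stable_consensus g (slush_state alpha (balanced n) (S w) t)].
have PE : (P E <= 2^-1%:E)%E by exact: slush_early_consensus_prob.
have mE : measurable E.
  rewrite (_ : E = \bigcup_(t in `I_T.+1)
     (fun w => slush_state alpha (balanced n) (S w) t) @^-1`
       [set x | stable_consensus g x]).
    by apply: fin_bigcup_measurable => // t _; exact: (measurable_slush_state _ _ hS).
  by apply/seteqP; split=> w [t tT Ct]; exists t.
(* Outside [E] the consensus time is at least T + 1, also when it is the infimum of the empty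
   set. *)
apply: le_trans (integral_ge_on_event (A := ~` E) (c := T.+1%:R) _ _ _ _ _).
- rewrite probability_setC //.
  have [p pE] : exists p, P E = p%:E.
    by exists (fine (P E)); rewrite fineK // fin_num_measure.
  move: PE; rewrite pE -EFinB -EFinM !lee_fin => p2.
  have lnk : 0 < ln k%:R :> R by rewrite ln_gt0 // ltr1n.
  have : ln n%:R / ln k%:R <= (trunc_log k n).+1%:R :> R.
    rewrite ler_pdivrMr // mulr_natl -lnXn ?ltr0n //; last by lia.
    rewrite ler_ln ?posrE ?exprn_gt0 ?ltr0n //; last by lia.
    by rewrite -natrX ler_nat ltnW // trunc_log_ltn.
  have : (trunc_log k n).+1%:R <= 6 * T.+1%:R :> R.
    by rewrite -natrM ler_nat /T; lia.
  have : 0 <= T.+1%:R :> R by [].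
  nra.
- exact: measurableC.
- by [].
- by move=> w; apply/ereal_infP => _ [t _ <-]; rewrite lee_fin.
- move=> w nEw; apply/ereal_infP => _ [t /= Ct <-]; rewrite lee_fin ler_nat.
  by rewrite ltnNge; apply/negP => tT; apply: nEw; exists t.
Qed.
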